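(* Let $n\ge 2$ be an integer with prime decomposition $n=p_1^{y_1}\cdots p_r^{y_r}$ (the $p_i$ pairwise distinct primes, $y_i\ge 1$) and let $$\Gamma_n=\langle a,t_1,\dots,t_r\mid t_it_j=t_jt_i\ (i\ne j),\ t_iat_i^{-1}=a^{p_i^{y_i}}\ (i=1,\dots,r)\rangle.$$ Let $H$ be a finite index subgroup of $\Gamma_n$, written as $$H=\langle t_1^{k_{11}}t_2^{k_{12}}\cdots t_r^{k_{1r}}a^{l_1},\ t_2^{k_{22}}\cdots t_r^{k_{2r}}a^{l_2},\ \dots,\ t_r^{k_{rr}}a^{l_r},\ a^m\rangle$$ for integers $k_{ii}>0$, $k_{ij}\ge 0$ ($i<j$), $l_i\in\mathbb{Z}$ and an integer $m>0$ such that $\gcd(m,n)=1$ and $H\cap\langle a\rangle=\langle a^m\rangle$, and let $\alpha=a^m$ and $x_i=t_i^{k_{ii}}\cdots t_r^{k_{ir}}a^{l_i}$ ($1\le i\le r$) be its generators. Then $$\Sigma^1(H)^c=\{[\xi_1],\dots,[\xi_r]\},$$ where $\xi_i:H\to\mathbb{R}$ is the homomorphism with $\xi_i(x_j)=k_{ji}$ if $j\le i$ and $\xi_i(x_j)=0$ if $j>i$. In other words, identifying $S(H)$ with $S^{r-1}$ via $[\chi]\mapsto (\chi(x_1),\dots,\chi(x_r))/\|(\chi(x_1),\dots,\chi(x_r))\|$, $$\Sigma^1(H)^c=\left\{\frac{(k_{11},0,0,\dots,0)}{\|(k_{11},0,0,\dots,0)\|},\ \frac{(k_{12},k_{22},0,\dots,0)}{\|(k_{12},k_{22},0,\dots,0)\|},\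 \dots,\ \frac{(k_{1r},k_{2r},k_{3r},\dots,k_{rr})}{\|(k_{1r},k_{2r},k_{3r},\dots,k_{rr})\|}\right\}.$$
   Context: For a finitely generated group $G$, the character sphere is $S(G)=(\mathrm{Hom}(G,\mathbb{R})\setminus\{0\})/\sim$, where $\chi\sim\chi'$ iff $r\chi=\chi'$ for some real $r>0$; $[\chi]$ denotes the class of $\chi$. Let $X$ be a finite generating set of $G$ and $\Gamma(G,X)$ the Cayley graph whose vertices are the elements of $G$, with edges joining $g$ and $gy$ for $g\in G$, $y\in X\cup X^{-1}$. For $\chi\in\mathrm{Hom}(G,\mathbb{R})\setminus\{0\}$, let $\Gamma_\chi$ be the full subgraph of $\Gamma(G,X)$ on the vertices $g$ with $\chi(g)\ge 0$. Then $\Sigma^1(G)=\{[\chi]\in S(G)\mid \Gamma_\chi \text{ is connected}\}$ (independent of $X$), and $\Sigma^1(G)^c$ is its complement in $S(G)$. In $H^{ab}$ the image of $\alpha$ is a torsion element and $x_1,\dots,x_r$ map to a basis of $H^{ab}$ modulo torsion, so every homomorphism $H\to\mathbb{R}$ vanishes on $\alpha$ and is determined by its arbitrary values on $x_1,\dots,x_r$. *)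

(* Defs.v *)
From Stdlib Require Import Relation_Operators.
From HB Require Import structures.
From mathcomp Require Import all_boot all_order all_algebra generic_quotient.
From mathcomp Require Import all_classical reals.

Set Implicit Arguments.
Unset Strict Implicit.
Unset Printing Implicit Defensive.
Import Order.TTheory GRing.Theory Num.Theory.

Local Open Scope classical_set_scope.
Local Open Scope quotient_scope.
Local Open Scope ring_scope.

(** * Groups given by generators and relations *)

(* A letter is a generator [(x, false)] or its formal inverse [(x, true)]. *)
Notation word X := (seq (X * bool)).

Section Presentation.
Variables (X : choiceType) (rel : word X -> word X -> Prop).
Implicit Types u v w : word X.

(* The congruence generated by free cancellation and by the relations
   [u = v] for [rel u v]. *)
Inductive pres_eq : word X -> word X -> Prop :=
| pres_refl w : pres_eq w w
| pres_sym u v : pres_eq u v -> pres_eq v u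
| pres_trans u v w : pres_eq u v -> pres_eq v w -> pres_eq u w
| pres_cat u u' v v' :
    pres_eq u u' -> pres_eq v v' -> pres_eq (u ++ v) (u' ++ v')
| pres_cancel x b : pres_eq [:: (x, b); (x, ~~ b)] [::]
| pres_rel u v : rel u v -> pres_eq u v.

Definition pres_eqb u v : bool := `[< pres_eq u v >].

Lemma pres_eqb_refl : reflexive pres_eqb.
Proof. by move=> w; apply/asboolP; exact: pres_refl. Qed.

Lemma pres_eqb_sym : symmetric pres_eqb.
Proof. by move=> u v; apply/asboolP/asboolP => /pres_sym. Qed.

Lemma pres_eqb_trans : transitive pres_eqb.
Proof.
by move=> v u w /asboolP uv /asboolP vw; apply/asboolP; exact: pres_trans uv vw.
Qed.

Canonical pres_equiv :=
  EquivRel pres_eqb pres_eqb_refl pres_eqb_sym pres_eqb_trans.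

(* The group [< X | u = v for all u, v such that rel u v >]. *)
Definition pres_group := {eq_quot pres_equiv}.

HB.instance Definition _ := Choice.on pres_group.
HB.instance Definition _ := EqQuotient.on pres_group.

Definition word_inv w : word X := rev [seq (y.1, ~~ y.2) | y <- w].

Definition word_class w : pres_group := \pi_pres_group w.

Lemma word_classP u v : word_class u = word_class v <-> pres_eq u v.
Proof.
split; first by move/eqquotP/asboolP.
by move=> uv; apply/eqquotP/asboolP.
Qed.

Lemma word_classK g : word_class (repr g) = g.
Proof. exact: reprK. Qed.

Lemma pres_repr w : pres_eq (repr (word_class w)) w.
Proof. by apply/word_classP; rewrite word_classK. Qed.

Lemma word_invK : involutive word_inv.
Proof.
move=> w; rewrite /word_inv map_rev revK -map_comp -[RHS]map_id.
by apply: eq_map => -[x b] /=; rewrite negbK.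
Qed.

Lemma word_inv_cat u v : word_inv (u ++ v) = word_inv v ++ word_inv u.
Proof. by rewrite /word_inv map_cat rev_cat. Qed.

Lemma pres_mulV w : pres_eq (w ++ word_inv w) [::].
Proof.
elim: w => [|[x b] w IHw]; first exact: pres_refl.
rewrite -cat1s word_inv_cat -catA (catA w).
apply: pres_trans (pres_cancel x b).
rewrite -[X in pres_eq _ X]/([:: (x, b)] ++ [::] ++ word_inv [:: (x, b)]).
apply: pres_cat; first exact: pres_refl.
apply: pres_cat => //; exact: pres_refl.
Qed.

Lemma pres_inv u v : pres_eq u v -> pres_eq (word_inv u) (word_inv v).
Proof.
move=> uv.
have vV : pres_eq (u ++ word_inv v) [::].
  by apply: pres_trans (pres_mulV v); apply: pres_cat => //; exact: pres_refl.
have uV : pres_eq (word_inv u ++ u) [::].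
  by have := pres_mulV (word_inv u); rewrite word_invK.
apply: (@pres_trans _ (word_inv u ++ u ++ word_inv v)).
  rewrite -[X in pres_eq X _]cats0; apply: pres_cat; first exact: pres_refl.
  exact: pres_sym.
rewrite catA -[X in pres_eq _ X]cat0s; apply: pres_cat => //; exact: pres_refl.
Qed.

Definition pres_mul (g h : pres_group) : pres_group :=
  word_class (repr g ++ repr h).
Definition pres_one : pres_group := word_class [::].
Definition pres_invg (g : pres_group) : pres_group :=
  word_class (word_inv (repr g)).

Lemma word_classM u v :
  word_class (u ++ v) = pres_mul (word_class u) (word_class v).
Proof.
by apply/word_classP; apply: pres_cat; apply: pres_sym; exact: pres_repr.
Qed.

Lemma word_classV w : word_class (word_inv w) = pres_invg (word_class w).
Proof. by apply/word_classP/pres_inv/pres_sym/pres_repr. Qed.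

Lemma pres_mulgA : associative pres_mul.
Proof.
move=> f g h; rewrite -[f]word_classK -[g]word_classK -[h]word_classK.
by rewrite -!word_classM catA.
Qed.

Lemma pres_mul1g : left_id pres_one pres_mul.
Proof. by move=> g; rewrite -[g]word_classK -word_classM. Qed.

Lemma pres_mulg1 : right_id pres_one pres_mul.
Proof. by move=> g; rewrite -[g]word_classK -word_classM cats0. Qed.

Lemma pres_mulVg : left_inverse pres_one pres_invg pres_mul.
Proof.
move=> g; rewrite -[g]word_classK -word_classV -word_classM.
by apply/word_classP; have := pres_mulV (word_inv (repr g)); rewrite word_invK.
Qed.

Lemma pres_mulgV : right_inverse pres_one pres_invg pres_mul.
Proof.
move=> g; rewrite -[g]word_classK -word_classV -word_classM.
by apply/word_classP; exact: pres_mulV.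
Qed.

HB.instance Definition _ := isGroup.Build pres_group
  pres_mulgA pres_mul1g pres_mulg1 pres_mulVg pres_mulgV.

Definition pres_gen (x : X) : pres_group := word_class [:: (x, false)].

End Presentation.

(** * The group Gamma_n *)

Section GammaRel.
Variables (r : nat) (p y : 'I_r -> nat).

(* The generator [a] is [None], the generator [t_i] is [Some i]. *)
Inductive Gamma_rel : word (option 'I_r) -> word (option 'I_r) -> Prop :=
| Gamma_comm i j : i != j ->
    Gamma_rel [:: (Some i, false); (Some j, false)]
              [:: (Some j, false); (Some i, false)]
| Gamma_conj i :
    Gamma_rel [:: (Some i, false); (None, false); (Some i, true)]
              (nseq (p i ^ y i) (None, false)).

End GammaRel.

Definition Gamma (r : nat) (p y : 'I_r -> nat) := pres_group (Gamma_rel p y).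

HB.instance Definition _ (r : nat) (p y : 'I_r -> nat) :=
  Group.on (Gamma p y).

Section GammaTheory.
Variables (r : nat) (p y : 'I_r -> nat).

Definition Gamma_a : Gamma p y := pres_gen (Gamma_rel p y) None.
Definition Gamma_t (i : 'I_r) : Gamma p y :=
  pres_gen (Gamma_rel p y) (Some i).

Lemma Gamma_commE i j : i != j ->
  (Gamma_t i * Gamma_t j)%g = (Gamma_t j * Gamma_t i)%g.
Proof.
move=> ij; rewrite -[LHS]word_classM -[RHS]word_classM.
by apply/word_classP/pres_rel; exact: Gamma_comm.
Qed.

Lemma Gamma_conjE i :
  (Gamma_t i * Gamma_a * (Gamma_t i)^-1)%g = (Gamma_a ^+ (p i ^ y i))%g.
Proof.
have aX n : word_class (Gamma_rel p y) (nseq n (None, false)) = (Gamma_a ^+ n)%g.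
  by elim: n => // n IHn; rewrite expgS -IHn -[RHS]word_classM.
rewrite -aX -[_^-1%g]word_classV -![RHS]/(word_class _ _).
rewrite -[(_ * Gamma_a)%g]word_classM -[LHS]word_classM.
by apply/word_classP/pres_rel; exact: Gamma_conj.
Qed.

End GammaTheory.

(** * Subgroups *)

Section Subgroups.
Variable G : groupType.

Definition zexpg (g : G) (z : int) : G :=
  match z with
  | Posz n => (g ^+ n)%g
  | Negz n => (g ^- n.+1)%g
  end.

Definition is_subgroup (A : set G) : Prop :=
  A 1%g /\ forall g h, A g -> A h -> A (g * h^-1)%g.

Definition gen (A : set G) : set G := smallest is_subgroup A.

Definition finite_index (A : set G) : Prop :=
  finite_set [set [set (g * h)%g | h in A] | g in [set: G]].

End Subgroups.

(* The product [t_i ^ k_ii ... t_r ^ k_ir a ^ l_i], in increasing order of the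
   indices; the entries of [k] below the diagonal are not used. *)
Definition Gamma_x (r : nat) (p y : 'I_r -> nat) (k : 'I_r -> 'I_r -> nat)
    (l : 'I_r -> int) (i : 'I_r) : Gamma p y :=
  ((\prod_(j < r | (i <= j)%N) Gamma_t p y j ^+ k i j) *
   zexpg (Gamma_a p y) (l i))%g.

(** * Characters and the invariant Sigma^1 *)

Section Sigma.
Variables (R : realType) (G : groupType).
Implicit Types (chi : G -> R) (X : set G).

Definition is_hom chi : Prop := forall g h, chi (g * h)%g = chi g + chi h.

Definition is_char chi : Prop := is_hom chi /\ exists g, chi g <> 0.

(* The class [chi] of a character, as the set of its positive multiples. *)
Definition char_class chi : set (G -> R) :=
  [set chi' | exists2 c : R, 0 < c & forall g, c * chi g = chi' g].

Definition char_sphere : set (set (G -> R)) :=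
  [set char_class chi | chi in is_char].

Definition cayley_edge X (g h : G) : Prop :=
  exists2 y, X y \/ X (y^-1)%g & h = (g * y)%g.

(* Connectedness of the full subgraph of the Cayley graph on the vertices V. *)
Definition cayley_connected X (V : set G) : Prop :=
  forall g h, V g -> V h ->
    clos_refl_trans G (fun u v => [/\ V u, V v & cayley_edge X u v]) g h.

Definition Sigma1 X : set (set (G -> R)) :=
  [set char_class chi | chi in
    [set chi | is_char chi /\ cayley_connected X [set g | 0 <= chi g]]].

Definition Sigma1c X : set (set (G -> R)) := char_sphere `\` Sigma1 X.

End Sigma.

Arguments char_sphere R G : clear implicits.

(** * Identification of the character sphere with a Euclidean sphere *)

Section Sphere.
Variables (R : realType) (r : nat).

(* The norm `| v | of the library on row vectors is the supremum norm. *)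
Definition enorm (v : 'rV[R]_r) : R := Num.sqrt (\sum_j v 0 j ^+ 2).

Definition unit_sphere : set 'rV[R]_r := [set v | enorm v = 1].

Definition normalize (v : 'rV[R]_r) : 'rV[R]_r := (enorm v)^-1 *: v.

Variables (G : groupType) (x : 'I_r -> G).

(* Computed on an arbitrary representative of the class; see [sphere_pointE]. *)
Definition sphere_point (c : set (G -> R)) : 'rV[R]_r :=
  normalize (\row_j xget (fun=> 0) c (x j)).

Lemma enormZ (c : R) (v : 'rV[R]_r) : 0 < c -> enorm (c *: v) = c * enorm v.
Proof.
move=> c0; rewrite /enorm; under eq_bigr do rewrite mxE exprMn.
by rewrite -mulr_sumr sqrtrM ?sqr_ge0// sqrtr_sqr gtr0_norm.
Qed.

Lemma sphere_pointE (chi : G -> R) :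
  sphere_point (char_class chi) = normalize (\row_j chi (x j)).
Proof.
rewrite /sphere_point; case: xgetP => [f _ [c c0 cE]|/(_ chi)[]]; last first.
  by exists 1 => // g; rewrite mul1r.
have -> : \row_j f (x j) = c *: \row_j chi (x j).
  by apply/rowP => j; rewrite !mxE cE.
rewrite /normalize enormZ// scalerA invfM mulrAC mulVf ?gt_eqF// mul1r //.
Qed.

End Sphere.

Arguments unit_sphere R r : clear implicits.

(* Main.v *)
Require Import Defs.
From HB Require Import structures.
From Stdlib Require Import Relation_Operators.
From mathcomp Require Import all_boot all_order all_algebra.
From mathcomp Require Import all_classical reals.
From mathcomp Require Import ring lra zify.

Set Implicit Arguments.
Unset Strict Implicit.
Unset Printing Implicit Defensive.
Import Order.TTheory GRing.Theory Num.Theory.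

Local Open Scope classical_set_scope.
Local Open Scope ring_scope.

(**
Put q_i = p_i ^ y_i. The group Gamma acts on the rationals by affine maps, a as
z |-> z + 1 and t_i as z |-> q_i z, and an element is determined by its
exponent vector e in Z^r together with its translation, the image of 0
([Gamma_faithful]). In particular the kernel of e is abelian, and conjugation
by w multiplies a translation in it by the product of the q_i ^ e_i(w), so
that it depends on e(w) alone. Finite index enters only through powers t_i ^ s
that lie in H and through the fact that each element of H in the kernel of e is
conjugate, within H, to a power of alpha = a ^ m ([ker_Hexponent]).

Every homomorphism chi from H to the reals kills alpha, because some power of
t_i conjugates alpha to a proper power of itself. Hence chi is determined by
its values on the x_j, and since the matrix of the e_i(x_j) is triangular with
the positive k_ii on the diagonal, chi = c_1 e_1 + ... + c_r e_r for a unique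
vector c. The homomorphism xi_i is the restriction of e_i to H. This gives the
identification of S(H) with the unit sphere; what remains is to decide, for each
c <> 0, whether the half space chi >= 0 is connected.

If chi = e_i, it is not ([exponent_half_space_disconnected]). Each step of a
path from 1 in the half space adds to the translation that of a letter,
multiplied by a scale factor without p_i in its denominator; so the powers of p_i in the
denominators of the translations that are reached are bounded. But
t_i ^ (- s k) alpha t_i ^ (s k) lies in the half space, and its translation
m / q_i ^ (s k) has an unbounded power of p_i in the denominator.

If c is not a positive multiple of a basis vector, then either some c_i < 0, or
two coordinates c_i, c_j are positive ([Hchar_connected]). In both cases
alpha is a product of conjugates u alpha^z u^-1 with chi(u) > 0: in the first
one conjugates alpha ^ (q_i ^ s) by u = t_i ^ (- s), in the second one combines
u = t_i ^ s and v = t_j ^ s through a Bezout relation between q_i ^ s and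
q_j ^ s. This suffices for connectedness ([half_space_connected]): conjugates
w alpha w^-1 with chi(w) large are joined to 1 inside the half space, the
decomposition of alpha lowers the bound on chi(w) step by step, hence all
conjugates of alpha, and the whole kernel of e, are joined to 1; and modulo
this kernel the group is abelian, so that the letters of a word can be
reordered with the ascending ones first, which keeps its path in the half
space.
*)

(** * Subgroups and integral powers *)

Section GroupBasics.
Variable G : groupType.
Implicit Types (g h : G) (z : int) (A : set G).

Lemma is_subgroup1 A : is_subgroup A -> A 1%g.
Proof. by case. Qed.

Lemma is_subgroupV A g : is_subgroup A -> A g -> A (g^-1)%g.
Proof. by move=> [A1 AF] Ag; rewrite -[(g^-1)%g]mul1g; exact: AF. Qed.

Lemma is_subgroupM A g h : is_subgroup A -> A g -> A h -> A (g * h)%g.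
Proof.
move=> sA Ag Ah; rewrite -[h]invgK; apply: (sA.2) => //.
exact: is_subgroupV.
Qed.

Lemma is_subgroupX A g n : is_subgroup A -> A g -> A (g ^+ n)%g.
Proof.
move=> sA Ag; elim: n => [|n IHn]; first exact: is_subgroup1.
by rewrite expgS; exact: is_subgroupM.
Qed.

Lemma is_subgroup_zexp A g z : is_subgroup A -> A g -> A (zexpg g z).
Proof.
by move=> sA Ag; case: z => n /=; [|apply: is_subgroupV => //];
  exact: is_subgroupX.
Qed.

Lemma gen_is_subgroup A : is_subgroup (gen A).
Proof.
split=> [B [sB _]|g h gA hA B [sB AB]]; first exact: is_subgroup1.
by apply: (sB.2); [exact: gA|exact: hA].
Qed.

Lemma sub_gen A : A `<=` gen A.
Proof. by move=> g Ag B [_ AB]; exact: AB. Qed.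

Lemma gen_sub A B : is_subgroup B -> A `<=` B -> gen A `<=` B.
Proof. by move=> sB AB g; apply. Qed.

Lemma zexpgS g z : zexpg g (z + 1) = (zexpg g z * g)%g.
Proof.
case: z => n; first by rewrite -PoszD addn1 /= expgSr.
rewrite NegzE; case: n => [|n]; first by rewrite addNr /= expg1 mulVg.
rewrite (_ : - n.+2%:Z + 1 = Negz n) /=; last by rewrite NegzE; lia.
by rewrite (expgS g n.+1) invgM mulgVK.
Qed.

Lemma zexpgD g z1 z2 : zexpg g (z1 + z2) = (zexpg g z1 * zexpg g z2)%g.
Proof.
elim: z2 => [|n IHn|n IHn]; first by rewrite addr0 /= mulg1.
  by rewrite intS addrCA addrC zexpgS IHn addrC zexpgS mulgA.
apply: (@mulIg _ g).
rewrite -mulgA -!zexpgS -addrA (_ : - n.+1%:Z + 1 = - n%:Z) //; lia.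
Qed.

Lemma zexpgN g z : zexpg g (- z) = ((zexpg g z)^-1)%g.
Proof. by apply/esym/mulg1_eq; rewrite -zexpgD subrr. Qed.

Lemma conj_zexpg h g z :
  (h * zexpg g z * h^-1)%g = zexpg (h * g * h^-1)%g z.
Proof.
have conjX n : (h * g ^+ n * h^-1)%g = ((h * g * h^-1) ^+ n)%g.
  by have := conjXg g h^-1%g n; rewrite !conjgE !invgK !mulgA.
case: z => n; first exact: conjX.
by rewrite /zexpg -conjX !invgM invgK mulgA.
Qed.

Lemma zexpgMn g n z : zexpg (g ^+ n)%g z = zexpg g (n%:Z * z).
Proof.
case: z => k; first by rewrite -PoszM /= expgnA.
by rewrite NegzE mulrN !zexpgN -PoszM /= expgnA.
Qed.

Lemma mem_gen1 g h : gen [set g] h -> exists z, h = zexpg g z.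
Proof.
suff : gen [set g] `<=` [set h | exists z, h = zexpg g z] by apply.
apply: gen_sub => [|_ ->]; last by exists 1.
split; first by exists 0.
by move=> _ _ [z1 ->] [z2 ->]; exists (z1 - z2); rewrite zexpgD zexpgN.
Qed.

(** Among the cosets g^n A two must coincide, which puts the quotient of the two
powers of g in A. *)
Lemma finite_index_expg A g : is_subgroup A -> finite_index A ->
  exists2 s, (0 < s)%N & A (g ^+ s)%g.
Proof.
move=> sA fA.
pose f n := [set (g ^+ n * h)%g | h in A].
have f_coset n : [set [set (c * h)%g | h in A] | c in [set: G]] (f n).
  by exists (g ^+ n)%g.
have [i [j [ltij fij]]] : exists i j, (i < j)%N /\ f i = f j.
  apply: contrapT => nofij; apply: infinite_nat.
  rewrite (_ : setT = f @^-1` [set [set (c * h)%g | h in A] | c in [set: G]]).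
    apply: finite_preimage => // i j _ _ fij.
    by case: (ltngtP i j) => // ij; case: nofij; [exists i, j|exists j, i].
  by apply/seteqP; split => // i _; exact: f_coset.
exists (j - i)%N; first by rewrite subn_gt0.
have : f i (g ^+ j)%g.
  by rewrite fij; exists 1%g; rewrite ?mulg1//; exact: is_subgroup1.
case=> h Ah gE; rewrite (_ : (g ^+ (j - i))%g = h) //.
by apply: (@mulgI _ (g ^+ i)%g); rewrite -expgnDr subnKC ?gE // ltnW.
Qed.

End GroupBasics.

(** * Connectedness of half spaces in Cayley graphs *)
Section Connectivity.
Variables (R : realType) (G : groupType).
Implicit Types (X : set G) (chi : G -> R) (g h w : G).

Lemma is_hom1 chi : is_hom chi -> chi 1%g = 0.
Proof.
by move=> chiM; apply/(addIr (chi 1%g)); rewrite -chiM mulg1 add0r.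
Qed.

Lemma is_homV chi g : is_hom chi -> chi (g^-1)%g = - chi g.
Proof.
by move=> chiM; apply/eqP; rewrite -addr_eq0 -chiM mulVg is_hom1.
Qed.

Lemma is_homX chi g n : is_hom chi -> chi (g ^+ n)%g = chi g *+ n.
Proof.
move=> chiM; elim: n => [|n IHn]; first by rewrite is_hom1.
by rewrite expgS chiM IHn mulrS.
Qed.

Definition half_connected X chi : G -> G -> Prop :=
  clos_refl_trans G (fun u v =>
    [/\ 0 <= chi u, 0 <= chi v & cayley_edge X u v]).

Section Fixed.
Variables (X : set G) (chi : G -> R).
Hypothesis chiM : is_hom chi.
Let conn := half_connected X chi.

Lemma half_connected_refl g : conn g g.
Proof. exact: rt_refl. Qed.

Lemma half_connected_trans g h w : conn g h -> conn h w -> conn g w.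
Proof. exact: rt_trans. Qed.

Lemma cayley_edge_sym g h : cayley_edge X g h -> cayley_edge X h g.
Proof.
case=> x Xx ->; exists (x^-1)%g; last by rewrite mulgK.
by rewrite invgK; case: Xx; [right|left].
Qed.

Lemma half_connected_sym g h : conn g h -> conn h g.
Proof.
elim=> [u v [u0 v0 uv]|u|u v w _ vu _ wv]; first apply: rt_step.
- by split => //; exact: cayley_edge_sym.
- exact: rt_refl.
- exact: rt_trans wv vu.
Qed.

Lemma half_connectedMl c g h : 0 <= chi c -> conn g h ->
  conn (c * g)%g (c * h)%g.
Proof.
move=> c0; elim=> [u v [u0 v0 uv]|u|u v w _ vu _ wv]; first apply: rt_step.
- rewrite !chiM; split; try exact: addr_ge0.
  by case: uv => x Xx ->; exists x => //; rewrite mulgA.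
- exact: rt_refl.
- exact: rt_trans vu wv.
Qed.

End Fixed.

(** A criterion for connectedness of the half space chi >= 0, for an arbitrary
generating set: e is a map onto an abelian quotient of G through which chi
factors, and its kernel consists of conjugates of powers of alpha, where
conjugation by g depends on e(g) only. *)
Section Criterion.
Variables (X : set G) (chi : G -> R) (A : zmodType) (e : G -> A).
Variables (alpha : G).
Hypothesis chiM : is_hom chi.
Hypothesis X_gen : gen X = [set: G].
Hypothesis eM : forall g h, e (g * h)%g = e g + e h.
Hypothesis chi_alpha : chi alpha = 0.
Hypothesis alpha_conj : forall g h, e g = e h ->
  (g * alpha * g^-1)%g = (h * alpha * h^-1)%g.
Hypothesis ker_e : forall g, e g = 0 ->
  exists h z, g = (h * zexpg alpha z * h^-1)%g.
Let conn := half_connected X chi.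

Let e1 : e 1%g = 0.
Proof. by apply/(addIr (e 1%g)); rewrite -eM mulg1 add0r. Qed.

Let eV g : e (g^-1)%g = - e g.
Proof. by apply/eqP; rewrite -addr_eq0 -eM mulVg e1. Qed.

Let chi_ker g : e g = 0 -> chi g = 0.
Proof.
move=> /ker_e[h [z ->]]; rewrite !chiM is_homV //.
rewrite (_ : chi (zexpg alpha z) = 0) ?addr0 ?subrr //.
by case: z => n /=; rewrite ?is_homV // is_homX // chi_alpha mul0rn ?oppr0.
Qed.

Let chi_eq g h : e g = e h -> chi g = chi h.
Proof.
move=> egh; apply/eqP; rewrite -subr_eq0 -is_homV // -chiM chi_ker //.
by rewrite eM eV egh subrr.
Qed.

(* Elements that can be appended to any vertex of the half space along a path
   that does not leave it, for instance letters on which chi is nonnegative. *)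
Let climbing g := 0 <= chi g /\ forall w, 0 <= chi w -> conn w (w * g)%g.

Let climbing1 : climbing 1%g.
Proof.
by split=> [|w _]; rewrite ?is_hom1 // mulg1; exact: half_connected_refl.
Qed.

Let climbingM g h : climbing g -> climbing h -> climbing (g * h)%g.
Proof.
move=> [g0 cg] [h0 ch]; split=> [|w w0]; first by rewrite chiM addr_ge0.
apply: (half_connected_trans (cg _ w0)); rewrite mulgA; apply: ch.
by rewrite chiM addr_ge0.
Qed.

Let climbing_letter x : X x \/ X (x^-1)%g -> 0 <= chi x -> climbing x.
Proof.
move=> Xx x0; split=> // w w0; apply: rt_step.
by rewrite chiM addr_ge0 //; split=> //; exists x.
Qed.

(* Modulo the kernel of e, the letters of a word for w can be permuted: those
   with chi >= 0 give a climbing element a, the inverses of the others a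
   climbing element b, and w' = a b^-1. The path to a climbs from 1; the path
   from a to w' is the reverse of one that climbs from w', where
   chi(w') = chi(w) >= 0. *)
Let mod_ker_connected w : 0 <= chi w ->
  exists2 w', e w' = e w & conn 1%g w'.
Proof.
have [a [b [ca cb ew]]] : exists a b, [/\ climbing a, climbing b &
    e w = e a - e b].
  suff : gen X `<=` [set w | exists a b, [/\ climbing a, climbing b &
      e w = e a - e b]] by apply; rewrite X_gen.
  apply: gen_sub => [|x Xx].
    split=> [|g h]; first by exists 1%g, 1%g; rewrite e1 subrr.
    move=> [a [b [ca cb ew]]] [a' [b' [ca' cb' ew']]].
    exists (a * b')%g, (b * a')%g; split; try exact: climbingM.
    by rewrite !eM eV ew ew' opprB opprD addrACA.
  have [x0|/ltW x0] := leP 0 (chi x).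
    exists x, 1%g; split => //; last by rewrite e1 subr0.
    by apply: climbing_letter => //; left.
  exists 1%g, (x^-1)%g; split => //; last by rewrite e1 eV sub0r opprK.
  apply: climbing_letter; first by right; rewrite invgK.
  by rewrite is_homV // oppr_ge0.
have ew' : e (a * b^-1)%g = e w by rewrite eM eV.
move=> w0; exists (a * b^-1)%g => //.
apply: (@half_connected_trans _ _ _ a).
  by have := ca.2 1%g; rewrite mul1g is_hom1 //; apply.
apply: half_connected_sym; rewrite -[X in half_connected _ _ _ X](mulgVK b a).
by apply: cb.2; rewrite (chi_eq ew').
Qed.

(* A fixed path from 1 to g, translated by w, stays in the half space once w is
   high enough to compensate for the lowest vertex of the path. *)
Let high_connected g : exists D, forall w, D <= chi w -> conn w (w * g)%g.
Proof.
suff : gen X `<=` [set g | exists D, forall w, D <= chi w -> conn w (w * g)%g].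
  by apply; rewrite X_gen.
apply: gen_sub => [|x Xx].
  split=> [|g1 g2 [D1 D1P] [D2 D2P]].
    by exists 0 => w _; rewrite mulg1; exact: half_connected_refl.
  exists (Num.max D1 (D2 - chi g1 + chi g2)) => w.
  rewrite ge_max => /andP[w1 w2].
  apply: (half_connected_trans (D1P _ w1)); apply: half_connected_sym.
  rewrite (_ : w * g1 = w * (g1 * g2^-1) * g2)%g; last by rewrite mulgA mulgVK.
  by apply: D2P; rewrite !chiM is_homV //; lra.
exists (Num.max 0 (- chi x)) => w; rewrite ge_max => /andP[w1 w2].
apply: rt_step; rewrite chiM; split => //; first by lra.
by exists x => //; left.
Qed.

(* Translation by an element on which chi vanishes preserves the half space, and
   this makes the reachable part of the kernel of chi a subgroup. *)
Let slice : set G := [set g | chi g = 0 /\ conn 1%g g].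

Let slice_is_subgroup : is_subgroup slice.
Proof.
split=> [|g h [g0 cg] [h0 ch]].
  by split; [exact: is_hom1|exact: half_connected_refl].
have gh0 : chi (g * h^-1)%g = 0 by rewrite chiM is_homV // g0 h0 subrr.
split=> //; apply: (half_connected_trans cg); apply: half_connected_sym.
have := @half_connectedMl X chi chiM (g * h^-1)%g 1%g h _ ch.
by rewrite mulg1 mulgVK gh0; apply.
Qed.

(** Conjugating the decomposition of alpha by w writes w alpha w^-1 in terms of
conjugates by w u and w v, which are higher than w; so the conjugates of alpha
by high elements, reachable by [high_connected], generate all the others. *)
Lemma half_space_connected (u v : G) (zu zv : int) :
  0 < chi u -> 0 < chi v ->
  alpha = (u * zexpg alpha zu * u^-1 * (v * zexpg alpha zv * v^-1))%g ->
  cayley_connected X [set g | 0 <= chi g].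
Proof.
move=> u_gt0 v_gt0 alphaE.
have [D DP] := high_connected alpha.
have high w : D <= chi w -> 0 <= chi w -> slice (w * alpha * w^-1)%g.
  move=> wD w0; have [w' ew cw'] := mod_ker_connected w0.
  have chi0 : chi (w' * alpha * w'^-1)%g = 0.
    by rewrite !chiM is_homV // chi_alpha addr0 subrr.
  (* From 1 to w', on to w' alpha, and back along the translate of the first
     path by w' alpha w'^-1. *)
  rewrite -(alpha_conj ew); split=> //.
  apply: (half_connected_trans cw').
  apply: (@half_connected_trans _ _ _ (w' * alpha)%g).
    by apply: DP; rewrite (chi_eq ew).
  apply: half_connected_sym.
  have := @half_connectedMl X chi chiM (w' * alpha * w'^-1)%g 1%g w' _ cw'.
  by rewrite mulg1 mulgVK chi0; apply.
pose E := Num.max D 0; pose d := Num.min (chi u) (chi v).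
have d_gt0 : 0 < d by rewrite lt_min u_gt0.
have all_conj n : forall w, E - d *+ n <= chi w -> slice (w * alpha * w^-1)%g.
  elim: n => [|n IHn] w.
    by rewrite subr0 ge_max => /andP[]; exact: high.
  move=> wn; have step t z : d <= chi t ->
      slice (w * (t * zexpg alpha z * t^-1) * w^-1)%g.
    move=> dt; rewrite (_ : (_ * _)%g =
      ((w * t) * zexpg alpha z * (w * t)^-1)%g); last by rewrite invgM !mulgA.
    rewrite conj_zexpg; apply: is_subgroup_zexp => //; apply: IHn.
    by rewrite chiM; rewrite mulrS in wn; lra.
  rewrite alphaE (_ : (_ * _)%g =
      (w * (u * zexpg alpha zu * u^-1) * w^-1 *
      (w * (v * zexpg alpha zv * v^-1) * w^-1))%g).
    by apply: is_subgroupM => //; apply: step; rewrite /d ge_min lexx ?orbT.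
  by rewrite -!mulgA mulKg.
have ker_slice g : e g = 0 -> slice g.
  move=> /ker_e[w [z ->]]; rewrite conj_zexpg; apply: is_subgroup_zexp => //.
  have := archi_boundP (le_trans (normr_ge0 _) (lexx `|(E - chi w) / d|)).
  set n := Num.bound _ => /ltW Hn; apply: (@all_conj n).
  have : (E - chi w) / d <= n%:R by apply: le_trans (ler_norm _) Hn.
  by rewrite ler_pdivrMr // mulr_natl; lra.
have from1 g : 0 <= chi g -> conn 1%g g.
  move=> g0; have [g' eg cg'] := mod_ker_connected g0.
  have [n0 cn] : slice (g * g'^-1)%g.
    by apply: ker_slice; rewrite eM eV eg subrr.
  apply: (half_connected_trans cn).
  have := @half_connectedMl X chi chiM (g * g'^-1)%g 1%g g' _ cg'.
  by rewrite mulg1 mulgVK n0; apply.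
move=> g h g0 h0; apply: half_connected_trans (from1 h h0).
exact/half_connected_sym/from1.
Qed.

End Criterion.
End Connectivity.
(** * Denominators along paths *)

(** The rationals whose denominator is prime to p, that is, the localization of
the integers at p, when p is prime. *)
Definition p_integral (p : nat) (z : rat) : Prop :=
  exists2 c : nat, coprime p c & c%:R * z \is a Num.int.

Section PIntegral.
Variable p : nat.
Implicit Types (z : rat) (d : nat).

Lemma int_p_integral z : z \is a Num.int -> p_integral p z.
Proof. by exists 1%N; rewrite ?coprimen1 // mul1r. Qed.

Lemma p_integralD z1 z2 :
  p_integral p z1 -> p_integral p z2 -> p_integral p (z1 + z2).
Proof.
move=> [c1 pc1 z1i] [c2 pc2 z2i]; exists (c1 * c2)%N.
  by rewrite coprimeMr pc1.
rewrite natrM mulrDr; apply: rpredD; last by rewrite -mulrA rpredM ?rpred_nat.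
by rewrite mulrAC rpredM ?rpred_nat.
Qed.

Lemma p_integralM z1 z2 :
  p_integral p z1 -> p_integral p z2 -> p_integral p (z1 * z2).
Proof.
move=> [c1 pc1 z1i] [c2 pc2 z2i]; exists (c1 * c2)%N.
  by rewrite coprimeMr pc1.
by rewrite natrM mulrACA rpredM.
Qed.

Lemma p_integral_prod (I : Type) (s : seq I) (F : I -> rat) :
  (forall i, p_integral p (F i)) -> p_integral p (\prod_(i <- s) F i).
Proof.
move=> Fp; apply: big_ind => //; last exact: p_integralM.
exact/int_p_integral/rpred1.
Qed.

(** The exponent s = d works because p ^ d > d cannot divide d. *)
Lemma not_p_integral_expV d N : prime p -> (p %| N)%N -> (0 < d)%N ->
  (0 < N)%N -> exists s, ~ p_integral p (d%:R / N%:R ^+ s).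
Proof.
move=> p_pr pN d_gt0 N_gt0; exists d => -[c pc /intrP[z]].
rewrite mulrA => /(canRL (divfK _)) cdE.
have {cdE} /(congr1 absz) : (c * d)%:Z = z * (N ^ d)%:Z.
  apply/eqP; rewrite -(eqr_int rat) intrM PoszM intrM -!pmulrn natrX.
  by rewrite cdE // expf_neq0 // pnatr_eq0 -lt0n.
rewrite abszM /= => cdE.
have : (p ^ d %| d)%N.
  rewrite -(Gauss_dvdr _ (_ : coprime (p ^ d) c)) ?coprimeXl //.
  by rewrite cdE dvdn_mull // dvdn_exp2r.
by move=> /(dvdn_leq d_gt0); rewrite leqNgt ltn_expl // prime_gt1.
Qed.
End PIntegral.

(** For an action by affine maps with translation part beta and scale lam, the
translations of the vertices joined to 1 have bounded denominators at p, as soon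
as the scale is p-integral on the half space: a step from u to u x adds
lam(u) beta(x). *)
Section Denominators.
Variables (R : realType) (G : groupType) (X : set G) (chi : G -> R).
Variables (p : nat) (beta lam : G -> rat).
Hypothesis X_fin : finite_set X.
Hypothesis beta1 : beta 1%g = 0.
Hypothesis betaM : forall g h, beta (g * h)%g = beta g + lam g * beta h.
Hypothesis lam_int : forall g, 0 <= chi g -> p_integral p (lam g).

(* A common denominator of the translations of the finitely many letters. *)
Let letter_denominator : exists2 d : nat, (0 < d)%N &
  forall x, X x \/ X (x^-1)%g -> d%:R * beta x \is a Num.int.
Proof.
have [s ->] := (finite_seqP X).1 X_fin.
suff [d d_gt0 dP] : exists2 d : nat, (0 < d)%N &
    forall x, x \in s -> d%:R * beta x \is a Num.int /\
      d%:R * beta (x^-1)%g \is a Num.int.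
  exists d => // x [/dP[]//|/dP[_]]; by rewrite invgK.
elim: s => [|x s [d d_gt0 dP]]; first by exists 1%N.
have mul_denq (z : rat) : (absz (denq z))%:R * z \is a Num.int.
  rewrite -[X in _ * X]divq_num_den pmulrn absz_denq mulrC divfK ?intr_int //.
  by rewrite intr_eq0 denq_neq0.
have denq_gt0 (z : rat) : (0 < absz (denq z))%N by rewrite absz_gt0 denq_neq0.
exists (d * (absz (denq (beta x)) * absz (denq (beta (x^-1)%g))))%N.
  by rewrite !muln_gt0 d_gt0 !denq_gt0.
move=> w; rewrite inE => /orP[/eqP ->|/dP[dw dwV]]; rewrite !natrM.
  split; rewrite -mulrA rpredM ?rpred_nat //; last first.
    by rewrite -mulrA rpredM ?rpred_nat.
  by rewrite mulrAC rpredM ?rpred_nat.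
by split; rewrite mulrAC rpredM // rpredM ?rpred_nat.
Qed.

Lemma half_connected_denominator : exists2 d : nat, (0 < d)%N &
  forall g, half_connected X chi 1%g g -> p_integral p (d%:R * beta g).
Proof.
have [d d_gt0 dP] := letter_denominator; exists d => // g conn1g.
suff : p_integral p (d%:R * beta 1%g) -> p_integral p (d%:R * beta g).
  by apply; rewrite beta1 mulr0; exact/int_p_integral/rpred0.
elim: conn1g => // [u v [u0 _ [x Xx ->]] du|u v w _ uv _ vw /uv/vw //].
rewrite betaM mulrDr mulrCA; apply: p_integralD => //.
by apply: p_integralM; [exact: lam_int|exact/int_p_integral/dP].
Qed.

End Denominators.
(** * The affine action of Gamma on the rationals *)

Section GammaModel.
Variables (r : nat) (p y : 'I_r -> nat).
Hypothesis p_gt0 : forall i, (0 < p i)%N.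
Local Notation q i := (p i ^ y i)%N.
Local Notation Gm := (Gamma p y).
Local Notation t := (Gamma_t p y).
Local Notation a := (Gamma_a p y).
Local Notation letter := (option 'I_r * bool)%type.
Implicit Types (g h : Gm) (w : seq letter) (u v : 'I_r -> nat) (z : int).

Let q_neq0 i : (q i)%:R != 0 :> rat.
Proof. by rewrite pnatr_eq0 -lt0n expn_gt0 p_gt0. Qed.

#[local] Hint Resolve q_neq0 : core.

Definition letter_exponent (c : letter) : 'rV[int]_r :=
  if c is (Some i, b) then (-1) ^+ b *: delta_mx 0 i else 0.

Definition word_exponent w : 'rV[int]_r := \sum_(c <- w) letter_exponent c.

Definition texponent g : 'rV[int]_r := word_exponent (repr g).

Definition tscale (e : 'rV[int]_r) : rat := \prod_i (q i)%:R ^ e 0 i.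

Definition letter_act (c : letter) (z : rat) : rat :=
  match c with
  | (None, false) => z + 1
  | (None, true) => z - 1
  | (Some i, false) => (q i)%:R * z
  | (Some i, true) => (q i)%:R^-1 * z
  end.

Definition word_act w (z : rat) : rat := foldr letter_act z w.

Definition translation g : rat := word_act (repr g) 0.

Lemma word_exponent_cat w1 w2 :
  word_exponent (w1 ++ w2) = word_exponent w1 + word_exponent w2.
Proof. exact: big_cat. Qed.

Lemma word_exponent_pres w1 w2 :
  pres_eq (@Gamma_rel _ p y) w1 w2 -> word_exponent w1 = word_exponent w2.
Proof.
elim=> // {w1 w2}.
- by move=> w1 w2 w3 _ -> _ ->.
- by move=> w1 w1' w2 w2' _ e1 _ e2; rewrite !word_exponent_cat e1 e2.
- move=> [i|] b; rewrite /word_exponent !big_cons !big_nil /= ?addr0 //.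
  by case: b; rewrite -scalerDl /= ?expr1 ?expr0 ?addNr ?subrr scale0r.
- move=> _ _ [i j _|i]; rewrite /word_exponent !big_cons big_nil /=.
    by rewrite !addr0 addrC.
  rewrite [RHS]big1_seq; last first.
    by move=> c /andP[_]; rewrite mem_nseq => /andP[_ /eqP ->].
  rewrite expr1 expr0 !scale1r scaleN1r addr0 add0r addrC.
  by rewrite addNr.
Qed.

Lemma word_act_cat w1 w2 (z : rat) :
  word_act (w1 ++ w2) z = word_act w1 (word_act w2 z).
Proof. exact: foldr_cat. Qed.

Lemma word_act_pres w1 w2 :
  pres_eq (@Gamma_rel _ p y) w1 w2 -> word_act w1 =1 word_act w2.
Proof.
elim=> // {w1 w2}.
- by move=> w1 w2 _ e12 z; rewrite e12.
- by move=> w1 w2 w3 _ e12 _ e23 z; rewrite e12.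
- by move=> w1 w1' w2 w2' _ e1 _ e2 z; rewrite !word_act_cat e2 e1.
- by move=> [i|] [] z /=; rewrite ?mulKf ?mulVKf ?subrK ?addrK.
- move=> _ _ [i j _|i] z /=; first by rewrite mulrCA.
  rewrite mulrDr mulVKf // mulr1.
  elim: (q i) => [|n IHn] /=; first by rewrite addr0.
  by rewrite -IHn -natr1 addrA.
Qed.

Lemma tscale0 : tscale 0 = 1.
Proof. by rewrite /tscale big1 // => i _; rewrite mxE expr0z. Qed.

Lemma tscaleD e1 e2 : tscale (e1 + e2) = tscale e1 * tscale e2.
Proof. by rewrite -big_split; apply: eq_bigr => i _; rewrite mxE expfzDr. Qed.

Lemma tscale_neq0 e : tscale e != 0.
Proof. by apply/prodf_neq0 => i _; rewrite expfz_neq0. Qed.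

Lemma tscaleN e : tscale (- e) = (tscale e)^-1.
Proof.
apply: (mulIf (tscale_neq0 e)).
by rewrite -tscaleD addNr tscale0 mulVf ?tscale_neq0.
Qed.

Lemma tscale_delta i z : tscale (z *: delta_mx 0 i) = (q i)%:R ^ z.
Proof.
rewrite /tscale (bigD1 i) //= big1 ?mulr1 => [|j /negPf ji].
  by rewrite !mxE !eqxx mulr1.
by rewrite !mxE eqxx ji mulr0 expr0z.
Qed.

Lemma word_act_affine w (z : rat) :
  word_act w z = word_act w 0 + tscale (word_exponent w) * z.
Proof.
elim: w => [|c w IHw] /=.
  by rewrite /word_exponent big_nil tscale0 mul1r add0r.
rewrite IHw /word_exponent big_cons -/(word_exponent w) tscaleD.
case: c => [[i|] b] /=; last first.
  by rewrite tscale0 mul1r; case: b; rewrite addrAC.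
rewrite tscale_delta.
by case: b; rewrite /= ?expr1 ?expr0 mulrDr mulrA.
Qed.

Lemma texponentM g h : texponent (g * h)%g = texponent g + texponent h.
Proof. by rewrite -word_exponent_cat; exact/word_exponent_pres/pres_repr. Qed.

Lemma translationM g h :
  translation (g * h)%g = translation g + tscale (texponent g) * translation h.
Proof.
rewrite [LHS](word_act_pres (pres_repr _ _)) word_act_cat.
exact: word_act_affine.
Qed.

Lemma texponent1 : texponent 1%g = 0.
Proof. by apply/(addIr (texponent 1%g)); rewrite -texponentM mulg1 add0r. Qed.

Lemma translation1 : translation 1%g = 0.
Proof. exact: (word_act_pres (pres_repr _ _)). Qed.

Lemma texponentV g : texponent (g^-1)%g = - texponent g.
Proof. by apply/eqP; rewrite -addr_eq0 -texponentM mulVg texponent1. Qed.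

Lemma texponentX g n : texponent (g ^+ n)%g = texponent g *+ n.
Proof.
elim: n => [|n IHn]; first exact: texponent1.
by rewrite expgS texponentM IHn mulrS.
Qed.

Lemma texponent_zexp g z : texponent g = 0 -> texponent (zexpg g z) = 0.
Proof.
by case: z => n g0 /=; rewrite ?texponentV texponentX g0 mul0rn ?oppr0.
Qed.

Lemma translationV g :
  translation (g^-1)%g = - ((tscale (texponent g))^-1 * translation g).
Proof.
rewrite -tscaleN -texponentV.
by apply/eqP; rewrite -addr_eq0 -translationM mulVg translation1.
Qed.

Lemma texponent_t i : texponent (t i) = delta_mx 0 i.
Proof.
rewrite [LHS](word_exponent_pres (pres_repr _ _)).
by rewrite /word_exponent big_seq1 /= scale1r.
Qed.

Lemma texponent_a : texponent a = 0.
Proof.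
rewrite [LHS](word_exponent_pres (pres_repr _ _)).
by rewrite /word_exponent big_seq1.
Qed.

Lemma translation_a : translation a = 1.
Proof. by rewrite [LHS](word_act_pres (pres_repr _ _)) /= add0r. Qed.

Lemma translation_zexp g z : texponent g = 0 ->
  translation (zexpg g z) = z%:~R * translation g.
Proof.
move=> g0; have gX n : translation (g ^+ n)%g = n%:R * translation g.
  elim: n => [|n IHn]; first by rewrite mul0r translation1.
  by rewrite expgSr translationM IHn texponentX g0 mul0rn tscale0 mulrSr; ring.
case: z => n; first by rewrite /= gX pmulrn.
rewrite /= translationV gX texponentX g0 mul0rn tscale0 invr1 mul1r NegzE.
by rewrite mulrNz mulNr pmulrn.
Qed.

Lemma translation_conj g h : texponent h = 0 ->
  translation (g * h * g^-1)%g = tscale (texponent g) * translation h.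
Proof.
move=> h0; rewrite !translationM translationV texponentM h0 addr0.
by rewrite mulrN mulVKf ?tscale_neq0 // addrAC subrr add0r.
Qed.

Lemma texponent_conj g h : texponent (g * h * g^-1)%g = texponent h.
Proof. by rewrite !texponentM texponentV addrAC subrr add0r. Qed.

Definition tmonomial u : Gm := (\prod_i t i ^+ u i)%g.

Let t_commute i j : commute (t i) (t j).
Proof.
by have [->|ij] := eqVneq i j; [exact: commute_refl|exact: Gamma_commE].
Qed.

Lemma commute_t_monomial i u : commute (t i) (tmonomial u).
Proof. by apply: commute_prod => j _; exact/commuteX/t_commute. Qed.

Lemma tmonomial_succ i u :
  tmonomial (fun j => (j == i) + u j)%N = (t i * tmonomial u)%g.
Proof.
rewrite /tmonomial; under eq_bigr do rewrite expgnDr.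
rewrite prodgM_commute; last by move=> j k _ _; exact/commuteX2/t_commute.
congr (_ * _)%g; rewrite -[RHS](big_pred1_eq *%g i t) [RHS]big_mkcond /=.
by apply: eq_bigr => j _; case: eqP.
Qed.

Lemma texponent_tmonomial u j : texponent (tmonomial u) 0 j = u j.
Proof.
rewrite (big_morph _ texponentM texponent1) summxE (bigD1 j) //= big1.
  rewrite texponentX texponent_t mulmxnE !mxE !eqxx addr0; exact: natz.
move=> i /negPf ij; rewrite texponentX texponent_t mulmxnE !mxE eqxx.
by rewrite eq_sym ij mul0rn.
Qed.

(** N is the product of the q_i ^ u_i; it is left unspecified because exponents
of a are later read off from translations. *)
Lemma tmonomial_conj_a u : exists N : nat,
  (tmonomial u * a * (tmonomial u)^-1 = a ^+ N)%g.
Proof.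
apply: (big_ind (fun g => exists N, g * a * g^-1 = a ^+ N)%g).
- by exists 1%N; rewrite invg1 mulg1 mul1g.
- move=> g h [N gN] [M hM]; exists (N * M)%N.
  rewrite invgM -[LHS]/(g * h * a * (h^-1 * g^-1))%g.
  have -> : (g * h * a * (h^-1 * g^-1) = g * (h * a * h^-1) * g^-1)%g.
    by rewrite !mulgA.
  by rewrite hM (conj_zexpg g a (Posz M)) /= gN expgnA.
- move=> i _; elim: (u i) => [|n [N IHn]].
    by exists 1%N; rewrite invg1 mulg1 mul1g.
  exists ((q i) * N)%N; rewrite expgS invgM.
  have -> : (t i * t i ^+ n * a * ((t i ^+ n)^-1 * (t i)^-1) =
      t i * (t i ^+ n * a * (t i ^+ n)^-1) * (t i)^-1)%g.
    by rewrite !mulgA.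
  by rewrite IHn (conj_zexpg (t i) a (Posz N)) /= Gamma_conjE expgnA.
Qed.

(** Multiplying the normal form by a letter on the left, a positive letter t_i
moves to the right through the inverse monomial and the power of a, a negative
one joins the inverse monomial, and a power of a moves through the inverse
monomial at the cost of a factor N in its exponent. *)
Lemma Gamma_normal_form g : exists u z v,
  g = ((tmonomial u)^-1 * zexpg a z * tmonomial v)%g.
Proof.
rewrite -[g]word_classK; elim: (repr g) => {g} [|c w [u [z [v wE]]]].
  exists (fun=> 0%N), 0, (fun=> 0%N).
  by rewrite mulg1 mulVg.
have -> : word_class (Gamma_rel p y) (c :: w) =
    (word_class (Gamma_rel p y) [:: c] * word_class (Gamma_rel p y) w)%g.
  exact: (word_classM _ [:: c]).
rewrite wE => {w wE}.
have letterV (i : option 'I_r) :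
    word_class (Gamma_rel p y) [:: (i, true)] =
    (pres_gen (Gamma_rel p y) i)^-1%g.
  by rewrite -[RHS]word_classV.
have aMu z' : (zexpg a z' * (tmonomial u)^-1)%g =
    ((tmonomial u)^-1 * zexpg (tmonomial u * a * (tmonomial u)^-1) z')%g.
  by rewrite -conj_zexpg -mulgA mulKg.
have [N aN] := tmonomial_conj_a u.
case: c => [[i|] b].
- case: b.
    exists (fun j => (j == i) + u j)%N, z, v.
    rewrite tmonomial_succ commute_t_monomial invgM letterV.
    by rewrite !mulgA.
  exists u, ((q i)%:Z * z), (fun j => (j == i) + v j)%N.
  have tU : (t i * (tmonomial u)^-1 = (tmonomial u)^-1 * t i)%g.
    exact/commuteV/commute_t_monomial.
  have tz : (t i * zexpg a z = zexpg a ((q i)%:Z * z) * t i)%g.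
    apply: (@mulIg _ (t i)^-1%g).
    by rewrite conj_zexpg Gamma_conjE zexpgMn mulgK.
  rewrite tmonomial_succ -[word_class _ _]/(t i) !mulgA tU.
  by rewrite -(mulgA _ (t i)) tz !mulgA.
- have -> : word_class (Gamma_rel p y) [:: (None, b)] = zexpg a ((-1) ^+ b).
    case: b; last by [].
    by rewrite letterV.
  exists u, (N%:Z * (-1) ^+ b + z), v.
  rewrite !mulgA aMu aN zexpgMn zexpgD.
  by rewrite !mulgA.
Qed.

Lemma ker_texponent g : texponent g = 0 -> exists u z,
  g = ((tmonomial u)^-1 * zexpg a z * tmonomial u)%g.
Proof.
move=> g0; have [u [z [v gE]]] := Gamma_normal_form g.
exists u, z; rewrite gE; congr (_ * _)%g.
apply: eq_bigr => i _; congr (_ ^+ _)%g.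
apply/eqP; rewrite -eqz_nat -!texponent_tmonomial; move: g0.
rewrite gE !texponentM texponentV texponent_zexp ?texponent_a // addr0.
by move/eqP; rewrite addrC subr_eq0 => /eqP ->.
Qed.

(** An element of the kernel of both maps is conjugate to a power of a with
translation 0, hence with exponent 0. *)
Lemma Gamma_faithful g h :
  translation g = translation h -> texponent g = texponent h -> g = h.
Proof.
move=> tgh egh.
have e0 : texponent (g * h^-1)%g = 0 by rewrite texponentM texponentV egh subrr.
have : translation (g * h^-1)%g = 0.
  rewrite translationM translationV egh tgh mulrN mulVKf ?tscale_neq0 //.
  by rewrite subrr.
have [u [z ghE]] := ker_texponent e0; rewrite ghE.
have ez : texponent (zexpg a z) = 0 by rewrite texponent_zexp ?texponent_a.
have := translation_conj (tmonomial u)^-1%g ez; rewrite invgK => ->.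
rewrite translation_zexp ?texponent_a // translation_a mulr1 => /eqP.
rewrite mulf_eq0 (negPf (tscale_neq0 _)) intr_eq0 => /eqP z0.
by apply/eqP; rewrite -divg_eq1 ghE z0 mulg1 mulVg.
Qed.

End GammaModel.
(** * Characters of a finite index subgroup *)

Lemma finite_index_expg_family (G : groupType) (I : finType) (A : set G)
    (f : I -> G) : is_subgroup A -> finite_index A ->
  exists2 s, (0 < s)%N & forall i, A (f i ^+ s)%g.
Proof.
move=> sA fA.
have /choice[s sP] : forall i, exists s, (0 < s)%N /\ A (f i ^+ s)%g.
  by move=> i; have [s] := finite_index_expg (f i) sA fA; exists s.
exists (\prod_i s i)%N => [|i].
  by apply: prodn_gt0 => i; case: (sP i).
rewrite (bigD1 i) //= expgnA; apply: is_subgroupX => //.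
by case: (sP i).
Qed.

Section SubgroupCarrier.
Variables (G : groupType) (S : {pred G}) (H : subGroupType S).

Lemma subgroup_carrier : is_subgroup [set` S].
Proof.
split=> /= [|g h gS hS]; first by rewrite -(val1 H); exact: valP.
rewrite -(SubK H gS) -(SubK H hS) -gmulfF; exact: valP.
Qed.

Lemma val_surj (g : G) : [set` S] g -> exists h : H, \val h = g.
Proof. by move=> gS; exists (@Sub _ _ H g gS); rewrite SubK. Qed.

Lemma val_zexpg (g : H) (z : int) : \val (zexpg g z) = zexpg (\val g) z.
Proof. by case: z => n /=; rewrite ?gmulfV gmulfXn. Qed.

End SubgroupCarrier.

Section FiniteIndexSubgroup.
Variables (R : realType) (r : nat) (p y : 'I_r -> nat).
Hypotheses (p_prime : forall i, prime (p i)) (p_inj : injective p).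
Hypothesis y_gt0 : forall i, (0 < y i)%N.
Variables (S : {pred Gamma p y}) (H : subGroupType S) (m : nat).
Hypothesis H_findex : finite_index [set` S].
Hypothesis m_gt0 : (0 < m)%N.
Hypothesis H_cap : [set` S] `&` gen [set Gamma_a p y] =
  gen [set (Gamma_a p y ^+ m)%g].
Local Notation q i := (p i ^ y i)%N.
Local Notation t := (Gamma_t p y).
Local Notation a := (Gamma_a p y).
Implicit Types (g h : H) (chi : H -> R) (c : 'rV[R]_r).

Let p_gt0 i : (0 < p i)%N. Proof. exact: prime_gt0. Qed.

Definition Hexponent h : 'rV[int]_r := texponent (\val h).

Lemma HexponentM g h : Hexponent (g * h)%g = Hexponent g + Hexponent h.
Proof. by rewrite /Hexponent valM texponentM. Qed.

Lemma Hexponent1 : Hexponent 1%g = 0.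
Proof. by rewrite /Hexponent val1 texponent1. Qed.

Lemma HexponentV g : Hexponent (g^-1)%g = - Hexponent g.
Proof. by rewrite /Hexponent gmulfV texponentV. Qed.

(** The linear combination of the r exponents with coefficients c; all
characters of H turn out to be of this form. *)
Definition Hchar c h : R := \sum_i c 0 i * (Hexponent h 0 i)%:~R.

Lemma Hchar_is_hom c : is_hom (Hchar c).
Proof.
move=> g h; rewrite -big_split; apply: eq_bigr => i _.
by rewrite HexponentM mxE rmorphD mulrDr.
Qed.

Lemma t_powers : exists s (tau : 'I_r -> H),
  (0 < s)%N /\ forall i, \val (tau i) = (t i ^+ s)%g.
Proof.
have [s s_gt0 sP] := finite_index_expg_family t (subgroup_carrier H) H_findex.
have /choice[tau tauE] := fun i => val_surj H (sP i).
by exists s, tau.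
Qed.

Lemma tscale_p_integral (i : 'I_r) (e : 'rV[int]_r) : 0 <= e 0 i ->
  p_integral (p i) (tscale p y e).
Proof.
move=> e0; apply: p_integral_prod => j.
have [<-|ij] := eqVneq i j.
  case: (e 0 i) e0 => // n _; apply: int_p_integral.
  by rewrite -exprnP rpredX // rpred_nat.
case: (e 0 j) => n.
  by apply: int_p_integral; rewrite -exprnP rpredX // rpred_nat.
exists (q j ^ n.+1)%N.
  rewrite !coprimeXr // prime_coprime // dvdn_prime2 //.
  by apply: contra ij => /eqP/p_inj ->.
rewrite NegzE -exprnN natrX divff ?rpred1 // expf_neq0 // pnatr_eq0 -lt0n.
by rewrite expn_gt0 p_gt0.
Qed.

Section Alpha.
Variables (alpha : H) (alphaE : \val alpha = (a ^+ m)%g).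

Let texponent_am : texponent (a ^+ m)%g = 0.
Proof. by rewrite texponentX texponent_a mul0rn. Qed.

Let translation_am : translation (a ^+ m)%g = m%:R.
Proof.
have := @translation_zexp _ _ _ p_gt0 a (Posz m) (texponent_a p y).
by rewrite (translation_a y p_gt0) mulr1 -pmulrn.
Qed.

Lemma Hexponent_conj_zexp g z : Hexponent (g * zexpg alpha z * g^-1)%g = 0.
Proof.
rewrite /Hexponent !valM gmulfV texponent_conj val_zexpg alphaE.
exact: texponent_zexp.
Qed.

Lemma translation_conj_zexp g z :
  translation (\val (g * zexpg alpha z * g^-1)%g) =
  z%:~R * tscale p y (Hexponent g) * m%:R.
Proof.
rewrite !valM gmulfV val_zexpg alphaE translation_conj //; last first.
  exact: texponent_zexp.
by rewrite translation_zexp // translation_am mulrCA mulrA.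
Qed.

Lemma H_faithful g h : translation (\val g) = translation (\val h) ->
  Hexponent g = Hexponent h -> g = h.
Proof. by move=> tgh egh; apply/val_inj/(Gamma_faithful p_gt0). Qed.

Lemma alpha_conj g h : Hexponent g = Hexponent h ->
  (g * alpha * g^-1)%g = (h * alpha * h^-1)%g.
Proof.
move=> egh; apply: H_faithful; last by rewrite !(@Hexponent_conj_zexp _ 1).
by rewrite !(@translation_conj_zexp _ 1) egh.
Qed.

Lemma alpha_split u v zu zv :
  zu%:~R * tscale p y (Hexponent u) + zv%:~R * tscale p y (Hexponent v) = 1 ->
  alpha = (u * zexpg alpha zu * u^-1 * (v * zexpg alpha zv * v^-1))%g.
Proof.
move=> uv1; apply: H_faithful; last first.
  by rewrite HexponentM !Hexponent_conj_zexp addr0 /Hexponent alphaE.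
rewrite valM translationM // !translation_conj_zexp.
rewrite -/(Hexponent _) Hexponent_conj_zexp tscale0 mul1r -mulrDl uv1 mul1r.
by rewrite alphaE translation_am.
Qed.

(** In the normal form g = T^-1 a^z T of an element of the kernel, T is a
monomial that need not be in H. Its power w = T^s does lie in H for a suitable s,
and w g w^-1 is still a power of a, since T^(s-1) acts on translations by an
integer N. This power lies in H, and is therefore a power of a^m. *)
Lemma ker_Hexponent g : Hexponent g = 0 ->
  exists h z, g = (h * zexpg alpha z * h^-1)%g.
Proof.
move=> g0; have [u [z gE]] := ker_texponent g0.
have [s0 [tau [s_gt0 tauE]]] := t_powers.
case: s0 s_gt0 tauE => // s _ tauE.
have wS : [set` S] (tmonomial p y (fun i => s.+1 * u i)%N).
  apply: (big_ind [set` S]); [|move=> ? ?|move=> i _].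
  - exact: is_subgroup1 (subgroup_carrier H).
  - exact: is_subgroupM (subgroup_carrier H).
  - rewrite expgnA -tauE; apply: is_subgroupX (valP _).
    exact: subgroup_carrier.
have [w wE] := val_surj H wS.
pose N := (\prod_i q i ^ (s * u i))%N.
have scaleN : N%:R =
    tscale p y (Hexponent w) / tscale p y (texponent (tmonomial p y u)).
  rewrite -tscaleN // -tscaleD // /tscale natr_prod; apply: eq_bigr => i _.
  rewrite !mxE /Hexponent wE !texponent_tmonomial.
  by rewrite mulSn PoszD addrAC subrr add0r natrX.
have wgE : \val (w * g * w^-1)%g = zexpg a (N%:Z * z).
  have ez z' : texponent (zexpg a z') = 0.
    by rewrite texponent_zexp ?texponent_a.
  apply: (Gamma_faithful p_gt0).
    rewrite !valM gmulfV translation_conj // gE.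
    rewrite -[X in (_ * zexpg _ _ * X)%g]invgK translation_conj //.
    rewrite texponentV tscaleN //.
    rewrite !translation_zexp ?texponent_a // (translation_a y p_gt0) !mulr1.
    by rewrite mulrA -scaleN rmorphM.
  by rewrite -[LHS]/(Hexponent _) !HexponentM HexponentV g0 addr0 subrr ez.
have [z' zE] : exists z', \val (w * g * w^-1)%g = zexpg (a ^+ m)%g z'.
  suff : gen [set (a ^+ m)%g] (\val (w * g * w^-1)%g) by exact: mem_gen1.
  rewrite -H_cap; split; first exact: valP.
  rewrite wgE; apply: (@is_subgroup_zexp _ (gen [set a])).
    exact: gen_is_subgroup.
  exact: sub_gen.
exists (w^-1)%g, z'; rewrite invgK.
have -> : zexpg alpha z' = (w * g * w^-1)%g.
  by apply: val_inj; rewrite zE val_zexpg alphaE.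
by rewrite !mulgA mulVg mul1g mulgVK.
Qed.

(** The power tau of t_i conjugates alpha to alpha^(q_i^s), and q_i^s > 1, so
chi(alpha) = q_i^s chi(alpha) forces chi(alpha) = 0. *)
Lemma hom_alpha chi (i : 'I_r) : is_hom chi -> chi alpha = 0.
Proof.
move=> chiM; have [s [tau [s_gt0 tauE]]] := t_powers.
have tauS : (tau i * alpha * (tau i)^-1 = alpha ^+ (q i ^ s))%g.
  apply: H_faithful; last first.
    rewrite (@Hexponent_conj_zexp _ 1) /Hexponent gmulfXn /= alphaE texponentX.
    by rewrite texponent_am mul0rn.
  rewrite (@translation_conj_zexp _ 1) mul1r gmulfXn /= alphaE.
  have := translation_zexp p_gt0 (Posz (q i ^ s)) texponent_am.
  rewrite /= translation_am => ->; congr (_ * _).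
  rewrite /Hexponent tauE texponentX texponent_t.
  rewrite -scaler_nat natz tscale_delta // -pmulrn; exact/esym/natrX.
have /eqP := congr1 chi tauS; rewrite !chiM is_homV // addrAC subrr add0r.
rewrite is_homX // eq_sym -subr_eq0 -{2}[chi alpha]mulr1n.
rewrite -mulrnBr ?expn_gt0 ?p_gt0 //.
rewrite mulrn_eq0 subn_eq0 leqNgt -{1}(exp1n s) ltn_exp2r // => /orP[|/eqP//].
by rewrite -{1}(exp1n (y i)) ltn_exp2r // prime_gt1.
Qed.

(** In terms of translations, a decomposition of alpha into conjugates by u
and v is a linear relation with integral coefficients between the scales of
u and v ([alpha_split]). *)
Lemma Hchar_connected (X : set H) c (i j : 'I_r) : gen X = [set: H] ->
  c 0 i < 0 \/ [/\ i != j, 0 < c 0 i & 0 < c 0 j] ->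
  cayley_connected X [set h | 0 <= Hchar c h].
Proof.
move=> X_gen cij; have [s [tau [s_gt0 tauE]]] := t_powers.
have etau l : Hexponent (tau l) = s%:Z *: delta_mx 0 l.
  by rewrite /Hexponent tauE texponentX texponent_t -scaler_nat natz.
have chi_tau l : Hchar c (tau l) = c 0 l *+ s.
  rewrite /Hchar (bigD1 l) //= big1 => [|l' /negPf ll'].
    by rewrite etau !mxE !eqxx mulr1 addr0 -pmulrn mulr_natr.
  by rewrite etau !mxE ll' andbF !mulr0.
have tscale_tau l : tscale p y (Hexponent (tau l)) = (q l ^ s)%:R.
  by rewrite etau tscale_delta //; exact/esym/natrX.
suff [u [v [zu [zv [u0 v0 uv1]]]]] : exists u v zu zv,
    [/\ 0 < Hchar c u, 0 < Hchar c v &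
      zu%:~R * tscale p y (Hexponent u) +
      zv%:~R * tscale p y (Hexponent v) = 1].
  apply: (half_space_connected (Hchar_is_hom c) X_gen HexponentM
    (hom_alpha i (Hchar_is_hom c)) alpha_conj ker_Hexponent u0 v0
    (alpha_split uv1)).
case: cij => [ci|[ij ci cj]].
  have tau0 : 0 < Hchar c (tau i)^-1%g.
    rewrite (is_homV _ (Hchar_is_hom c)) chi_tau oppr_gt0.
    by rewrite pmulrn_llt0.
  (* One conjugate is enough here, so the second one has exponent 0. *)
  exists (tau i)^-1%g, (tau i)^-1%g, (Posz (q i ^ s)), 0; split=> //.
  rewrite HexponentV tscaleN // tscale_tau mul0r addr0 -pmulrn divff //.
  by rewrite pnatr_eq0 -lt0n !expn_gt0 p_gt0.
have : coprimez (Posz (q i ^ s)) (Posz (q j ^ s)).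
  rewrite /coprimez /gcdz /= -[_ == _]/(coprime _ _).
  rewrite !(coprimeXl, coprimeXr) // prime_coprime // dvdn_prime2 //.
  by apply: contra ij => /eqP/p_inj ->.
case/coprimezP => -[zu zv] /= zuv; exists (tau i), (tau j), zu, zv.
rewrite !chi_tau !pmulrn_lgt0 //; split=> //.
by rewrite !tscale_tau !pmulrn -!intrM -intrD zuv.
Qed.

(** The elements w alpha w^-1 with w = tau_i^-k have exponent 0 and translation
m / q_i^(s k), whose denominator at p_i is unbounded. *)
Lemma exponent_half_space_disconnected (X : set H) (i : 'I_r) : finite_set X ->
  ~ cayley_connected X [set h | 0 <= (Hexponent h 0 i)%:~R :> R].
Proof.
move=> X_fin conn; have [s [tau [s_gt0 tauE]]] := t_powers.
pose chi h : R := (Hexponent h 0 i)%:~R.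
have lam_int h : 0 <= chi h -> p_integral (p i) (tscale p y (Hexponent h)).
  by rewrite ler0z; exact: tscale_p_integral.
have [d d_gt0 dP] := half_connected_denominator X_fin
  (etrans (congr1 (@translation _ p y) (val1 H)) (translation1 y p_gt0))
  (fun g h => etrans (congr1 (@translation _ p y) (valM g h))
    (translationM p_gt0 (\val g) (\val h))) lam_int.
have [k] : exists k, ~ p_integral (p i) ((d * m)%:R / (q i ^ s)%:R ^+ k).
  apply: not_p_integral_expV => //.
  - by rewrite !dvdn_exp.
  - by rewrite muln_gt0 d_gt0.
  - by rewrite !expn_gt0 p_gt0.
apply; pose w := (tau i ^- k)%g.
suff -> : (d * m)%:R / (q i ^ s)%:R ^+ k =
    d%:R * translation (\val (w * zexpg alpha 1 * w^-1)%g).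
  apply: dP; apply: conn => /=; first by rewrite Hexponent1 mxE.
  by rewrite (@Hexponent_conj_zexp _ 1) mxE.
rewrite translation_conj_zexp mul1r natrM mulrAC -mulrA; congr (_ * (_ * _)).
rewrite /w HexponentV tscaleN //; congr (_^-1).
rewrite /Hexponent gmulfXn /= tauE !texponentX texponent_t -mulrnA.
by rewrite -scaler_nat natz tscale_delta // -exprnP exprM natrX.
Qed.

End Alpha.
End FiniteIndexSubgroup.
(** * The character sphere *)

Lemma char_class_refl (R : realType) (G : groupType) (chi : G -> R) :
  char_class chi chi.
Proof. by exists 1 => // g; rewrite mul1r. Qed.

Lemma char_class_scale (R : realType) (G : groupType) (chi chi' : G -> R)
    (c : R) :
  0 < c -> (forall g, c * chi g = chi' g) -> char_class chi = char_class chi'.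
Proof.
move=> c_gt0 cE; apply/seteqP; split=> f [d d_gt0 dE].
  exists (d / c); first by rewrite divr_gt0.
  by move=> g; rewrite -cE -dE mulrA divfK // gt_eqF.
by exists (d * c); rewrite ?mulr_gt0 // => g; rewrite -mulrA cE.
Qed.

Lemma char_class_Sigma1 (R : realType) (G : groupType) (X : set G)
    (chi : G -> R) : is_char chi ->
  Sigma1 X (char_class chi) <-> cayley_connected X [set g | 0 <= chi g].
Proof.
move=> chiP; split=> [[f [fP f_conn] fchi]|conn]; last by exists chi.
have [c c_gt0 cE] : char_class f chi by rewrite fchi; exact: char_class_refl.
rewrite (_ : [set g | 0 <= chi g] = [set g | 0 <= f g]) //.
by apply/seteqP; split=> g /=; rewrite -cE pmulr_rge0.
Qed.

Section Normalize.
Variables (R : realType) (r : nat).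
Implicit Types v : 'rV[R]_r.

Lemma enorm_gt0 v : v != 0 -> 0 < enorm v.
Proof.
move=> v0; rewrite sqrtr_gt0 lt0r sumr_ge0 ?andbT => [|j _]; last first.
  exact: sqr_ge0.
apply: contra v0; rewrite psumr_eq0 => [/allP v0|j _]; last exact: sqr_ge0.
apply/eqP/rowP => j; rewrite mxE; apply/eqP; rewrite -sqrf_eq0.
by apply: v0; rewrite mem_index_enum.
Qed.

Lemma enorm_normalize v : v != 0 -> enorm (normalize v) = 1.
Proof.
by move=> /enorm_gt0 v0; rewrite enormZ ?invr_gt0 // mulVf // gt_eqF.
Qed.

Lemma normalize_eq u v : u != 0 -> v != 0 -> normalize u = normalize v ->
  exists2 c : R, 0 < c & v = c *: u.
Proof.
move=> /enorm_gt0 u0 /enorm_gt0 v0 uv; exists (enorm v / enorm u).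
  exact: divr_gt0.
by rewrite -scalerA -/(normalize u) uv scalerA divff ?scale1r // gt_eqF.
Qed.

End Normalize.

Lemma texponent_Gamma_x (r : nat) (p y : 'I_r -> nat) (k : 'I_r -> 'I_r -> nat)
    (l : 'I_r -> int) (i j : 'I_r) :
  texponent (Gamma_x p y k l j) 0 i = if (j <= i)%N then k j i else 0%N.
Proof.
rewrite texponentM texponent_zexp ?texponent_a // addr0.
rewrite (big_morph _ (@texponentM _ p y) (texponent1 p y)) summxE big_mkcond /=.
rewrite (bigD1 i) //= big1 ?addr0 => [|i' /negPf ii'].
  case: leqP => // _.
  rewrite texponentX texponent_t mulmxnE !mxE !eqxx; exact: natz.
case: leqP => // _; rewrite texponentX texponent_t mulmxnE !mxE eqxx.
by rewrite eq_sym ii' mul0rn.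
Qed.

Lemma is_hom_eq_gen (R : realType) (G : groupType) (S : {pred G})
    (H : subGroupType S) (A : set G) (chi chi' : H -> R) :
  is_hom chi -> is_hom chi' -> [set` S] = gen A ->
  (forall h, A (\val h) -> chi h = chi' h) -> chi = chi'.
Proof.
move=> chiM chiM' SA chiA; apply/funext => h.
have sS := subgroup_carrier H.
suff : gen A `<=` [set g | S g /\ forall h, \val h = g -> chi h = chi' h].
  move=> /(_ (\val h))[|_]; last exact.
  rewrite -SA; exact: valP.
apply: gen_sub => [|g Ag].
  split=> [|_ _ [/(val_surj H)[g <-] gE] [/(val_surj H)[g' <-] gE']].
    split; first exact: sS.1.
    move=> h1; rewrite -(val1 H) => /val_inj ->.
    by rewrite !is_hom1.
  split; first by apply: sS.2; exact: valP.
  move=> h1; rewrite -gmulfF => /val_inj ->.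
  by rewrite chiM chiM' !is_homV // (gE g) // (gE' g').
split; first by suff : [set` S] g by []; rewrite SA; exact: sub_gen.
by move=> h1 h1g; apply: chiA; rewrite h1g.
Qed.

Theorem theorem3p8 (R : realType) (n r : nat) (p y : 'I_r -> nat)
    (n_ge2 : (2 <= n)%N)
    (p_prime : forall i, prime (p i)) (p_inj : injective p)
    (y_ge1 : forall i, (1 <= y i)%N)
    (n_decomp : n = (\prod_(i < r) p i ^ y i)%N)
    (S : {pred Gamma p y}) (H : subGroupType S)
    (H_findex : finite_index [set` S])
    (k : 'I_r -> 'I_r -> nat) (l : 'I_r -> int) (m : nat)
    (k_diag : forall i, (0 < k i i)%N) (m_gt0 : (0 < m)%N)
    (H_gen : [set` S] =
       gen ([set Gamma_x p y k l i | i in [set: 'I_r]] `|`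
            [set (Gamma_a p y ^+ m)%g]))
    (m_n : coprime m n)
    (H_cap : [set` S] `&` gen [set Gamma_a p y] =
             gen [set (Gamma_a p y ^+ m)%g])
    (x : 'I_r -> H) (xE : forall i, \val (x i) = Gamma_x p y k l i)
    (X : set H) (X_fin : finite_set X) (X_gen : gen X = [set: H]) :
  [/\ exists xi : 'I_r -> H -> R,
        (forall i : 'I_r, unique (fun chi : H -> R => is_hom chi /\
           forall j : 'I_r, chi (x j) = if (j <= i)%N then (k j i)%:R else 0)
           (xi i)) /\
        Sigma1c X = [set char_class (xi i) | i in [set: 'I_r]],
      set_bij (char_sphere R H) (unit_sphere R r) (sphere_point x) &
      sphere_point x @` Sigma1c X =
        [set normalize (\row_(j < r) (if (j <= i)%N then (k j i)%:R else 0 : R))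
           | i in [set: 'I_r]]].
Proof.
have p_gt0 i : (0 < p i)%N by exact: prime_gt0.
have [i0 _] : exists i0 : 'I_r, True.
  have [r0|r_gt0] := posnP r; last by exists (Ordinal r_gt0).
  move: n_ge2; rewrite n_decomp big1 // => i.
  by have := ltn_ord i; rewrite [X in (_ < X)%N]r0.
have [alpha alphaE] : exists alpha : H, \val alpha = (Gamma_a p y ^+ m)%g.
  by apply: val_surj; rewrite H_gen; apply: sub_gen; right.
have alpha0 chi : is_hom chi -> chi alpha = 0 :> R.
  exact: (hom_alpha p_prime y_ge1 H_findex alphaE i0).
have hom_eq (chi chi' : H -> R) : is_hom chi -> is_hom chi' ->
    (forall j, chi (x j) = chi' (x j)) -> chi = chi'.
  move=> chiM chiM' chi_x; apply: (is_hom_eq_gen chiM chiM' H_gen) => h.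
  case=> [[j _]|] hE.
    have -> : h = x j by apply: val_inj; rewrite -hE xE.
    exact: chi_x.
  have -> : h = alpha by apply: val_inj; rewrite hE alphaE.
  by rewrite (alpha0 _ chiM) (alpha0 _ chiM').
(* Row i of K lists the values at the x_j of the i-th exponent. *)
pose K : 'M[R]_r := \matrix_(i, j) (if (j <= i)%N then (k j i)%:R else 0).
have K_unit : K \in unitmx.
  rewrite unitmxE det_trig ?unitfE.
    by apply/prodf_neq0 => i _; rewrite mxE leqnn pnatr_eq0 -lt0n.
  by apply/is_trig_mxP => i j; rewrite mxE ltnNge => /negPf ->.
have Hchar_x (c : 'rV[R]_r) j : Hchar c (x j) = (c *m K) 0 j.
  rewrite mxE; apply: eq_bigr => i _; rewrite mxE /Hexponent xE.
  by rewrite texponent_Gamma_x; case: ifP; rewrite -?pmulrn.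
have Hchar_surj (chi : H -> R) : is_hom chi ->
    exists c : 'rV[R]_r, chi = Hchar c.
  move=> chiM; exists ((\row_j chi (x j)) *m invmx K).
  apply: hom_eq => // [|j]; first exact: Hchar_is_hom.
  by rewrite Hchar_x mulmxKV // mxE.
pose xi (i : 'I_r) : H -> R := Hchar (delta_mx 0 i).
have xi_hom i : is_hom (xi i) by exact: Hchar_is_hom.
have xi_x i j : xi i (x j) = if (j <= i)%N then (k j i)%:R else 0.
  by rewrite /xi Hchar_x -rowE !mxE.
have xiE i h : xi i h = (Hexponent h 0 i)%:~R.
  rewrite /xi /Hchar (bigD1 i) //= big1 => [|j /negPf ji].
    by rewrite !mxE !eqxx mul1r addr0.
  by rewrite !mxE ji andbF mul0r.
have xi_char i : is_char (xi i).
  split=> //; exists (x i); rewrite xi_x leqnn; apply/eqP.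
  by rewrite pnatr_eq0 -lt0n.
have SigmaE : Sigma1c X = [set char_class (xi i) | i in [set: 'I_r]].
  apply/seteqP; split=> [_ [[chi chiP <-] /(char_class_Sigma1 X chiP) not_conn]|
      _ [i _ <-]]; last first.
    split; first by exists (xi i).
    move=> /(char_class_Sigma1 X (xi_char i)).
    under eq_set do rewrite xiE.
    exact: (exponent_half_space_disconnected p_prime p_inj y_ge1 H_findex m_gt0
      alphaE X_fin).
  (* A character Hchar c outside Sigma^1 has no negative coefficient and at most
     one positive one. *)
  have [c cE] := Hchar_surj _ chiP.1; rewrite cE in chiP not_conn *.
  have conn i j : c 0 i < 0 \/ [/\ i != j, 0 < c 0 i & 0 < c 0 j] -> False.
    move=> cij; apply: not_conn.
    exact: (Hchar_connected p_prime p_inj y_ge1 H_findex H_cap alphaE X_gen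
      cij).
  have c_ge0 i : 0 <= c 0 i.
    by rewrite leNgt; apply/negP => ci; apply: (conn i i); left.
  have [i ci] : exists i, 0 < c 0 i.
    apply: contrapT => no_i; have [_ [h]] := chiP; apply.
    apply: big1 => i _; rewrite (_ : c 0 i = 0) ?mul0r //.
    apply/eqP; rewrite eq_le c_ge0 andbT leNgt; apply/negP => ci.
    by apply: no_i; exists i.
  exists i => //; apply: (char_class_scale ci) => h.
  rewrite xiE /Hchar (bigD1 i) //= big1 ?addr0 // => j ji.
  rewrite (_ : c 0 j = 0) ?mul0r //.
  apply/eqP; rewrite eq_le c_ge0 andbT leNgt; apply/negP => cj.
  by apply: (conn j i); right.
have row_neq0 (chi : H -> R) : is_char chi -> \row_j chi (x j) != 0 :> 'rV[R]_r.
  move=> [chiM [h chi_h]]; apply/eqP => /rowP chi_x; apply: chi_h.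
  rewrite (hom_eq chi (fun=> 0)) // => [g g'|j]; first by rewrite addr0.
  by have := chi_x j; rewrite !mxE.
split.
- exists xi; split=> // i; split=> [|chi [chiM chi_x]]; first by [].
  by apply: hom_eq => // j; rewrite xi_x chi_x.
- split.
  + move=> _ [chi chiP <-]; rewrite /unit_sphere /= sphere_pointE.
    exact/enorm_normalize/row_neq0.
  + move=> _ _ /set_mem[chi chiP <-] /set_mem[chi' chiP' <-].
    rewrite !sphere_pointE => /normalize_eq[||c c_gt0 cE]; try exact: row_neq0.
    apply: (char_class_scale c_gt0) => g.
    suff <- : (fun h => c * chi h) = chi' by [].
    apply: hom_eq; [|exact: chiP'.1|].
      by move=> h h'; rewrite chiP.1 mulrDr.
    by move=> j; move/rowP: cE => /(_ j); rewrite !mxE.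
  + move=> v /= v1; pose chi := Hchar (v *m invmx K) : H -> R.
    have chi_x : \row_j chi (x j) = v.
      by apply/rowP => j; rewrite mxE /chi Hchar_x mulmxKV.
    exists (char_class chi); last first.
      by rewrite sphere_pointE chi_x /normalize v1 invr1 scale1r.
    exists chi => //; split; first exact: Hchar_is_hom.
    apply: contrapT => chi0; have : enorm v = 0; last first.
      by rewrite v1 => /eqP; rewrite oner_eq0.
    rewrite -chi_x /enorm big1 ?sqrtr0 // => j _.
    rewrite mxE (_ : chi (x j) = 0) ?expr0n //.
    by apply: contrapT => chi_xj; apply: chi0; exists (x j).
- rewrite SigmaE image_comp; apply: eq_imagel => i _ /=.
  rewrite sphere_pointE; congr normalize; apply/rowP => j.
  by rewrite !mxE xi_x.
Qed.
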